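(* In the setting of the context there is a constant $N\in(0,\infty)$ depending only on $K$ and $d_1$ such that, if for a number $c_0\ge0$ $$\lambda+\frac{1-e^{-c_0\tau}}{\tau}>N,$$ and $\varepsilon\in(0,Kh]$, then on $Q$ $$|\delta_{\varepsilon,\pm l}u|\le Ne^{c_0(T+\tau)}\Big(1+|u|_{0,Q}+\max_{\partial_\varepsilon Q}\big(\max_k|\delta_{h,\ell_k}u|+|\delta_{\varepsilon,l}u|+|\delta_{\varepsilon,-l}u|\big)\Big).$$
   Context: Data. $A$ is a separable metric space; $T\in(0,\infty)$, $K\in[1,\infty)$, $\lambda\in[0,\infty)$; $d,d_1\ge1$ integers; $k$ runs through $\pm1,\dots,\pm d_1$; $\tau,h>0$. Given are $\ell_k\in\mathbb R^{d}$ and real-valued functions $\sigma^{\alpha}_k,b^{\alpha}_k,c^{\alpha},f^{\alpha}$ of $(t,x)\in\mathbb R\times\mathbb R^d$, $\alpha\in A$, Borel in $t$ and continuous in $\alpha$, with $\ell_k=-\ell_{-k}$, $|\ell_k|\le K$, $\sigma^{\alpha}_k=\sigma^{\alpha}_{-k}$, $b^{\alpha}_k\ge0$, $c^{\alpha}\ge\lambda$; $a^{\alpha}_k=\tfrac12(\sigma^{\alpha}_k)^2$. Notation. For $\eta>0$, $m\in\mathbb R^d$: $\delta_{\eta,m}u(t,x)=\frac{u(t,x+\eta m)-u(t,x)}{\eta}$; $\Delta_{h,m}u(t,x)=\frac{u(t,x+hm)-2u(t,x)+u(t,x-hm)}{h^2}$; $\tau_T(t)=\min(\tau,T-t)$;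 $\delta^T_\tau u(t,x)=\frac{u(t+\tau_T(t),x)-u(t,x)}{\tau}$; $|u|_{0,Q}=\sup_Q|u|$. Mesh. $\bar{\mathcal M}_T$ is the set of $(t,x)\in[0,T]\times\mathbb R^d$ with $t=\min(j\tau,T)$, $x=h(i_1\ell_1+\dots+i_{d_1}\ell_{d_1})$, $j=0,1,\dots$, $i_k\in\mathbb Z$. For $\varepsilon\in(0,Kh]$ and a unit vector $l\in\mathbb R^d$, $\bar{\mathcal M}_T(\varepsilon)=\{(t,x+i\varepsilon l):(t,x)\in\bar{\mathcal M}_T,\ i\in\mathbb Z\}$. $Q\subset\bar{\mathcal M}_T(\varepsilon)$ is a nonempty finite set, $Q'=Q\cap([0,T)\times\mathbb R^d)$, $$Q^o_\varepsilon=\{(t,x)\in Q':(t+\tau_T(t),x),\,(t,x\pm h\ell_k),\,(t,x\pm\varepsilon l)\in Q\ \ \forall k=1,\dots,d_1\},\qquad \partial_\varepsilon Q=Q\setminus Q^o_\varepsilon.$$ Equation. $u$ is a real function on $\bar{\mathcal M}_T(\varepsilon)$ satisfying in $Q'$ $$\delta^T_\tau u+\sup_{\alpha\in A}\Big[\sum_k a^{\alpha}_k\Delta_{h,\ell_k}u+\sum_k b^{\alpha}_k\delta_{h,\ell_k}u-c^{\alpha}u+f^{\alpha}\Big]=0 .$$ Assumption on coefficients (no other regularity in $x$ is assumed). In $Q^o_\varepsilon$, for all $\alpha\in A$ and all $j,k\in\{\pm1,\dots,\pm d_1\}$: for $\psi=b^{\alpha}_k,\ c^{\alpha}-\lambda,\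 f^{\alpha}$ one has $|\psi|\le K$, $|\delta_{h,\ell_j}\psi|\le K$, $|\delta_{\varepsilon,\pm l}\psi|\le K$; and $$0\le a^{\alpha}_k\le K,\qquad |\delta_{h,\ell_j}a^{\alpha}_k|\le K\sqrt{a^{\alpha}_k}+Kh,\qquad |\delta_{\varepsilon,\pm l}a^{\alpha}_k|\le K\sqrt{a^{\alpha}_k}+Kh .$$ *)

(* Defs.v *)
From HB Require Import structures.
From mathcomp Require Import all_boot all_order all_algebra.
From mathcomp Require Import all_classical all_reals all_analysis.

Set Implicit Arguments.
Unset Strict Implicit.
Unset Printing Implicit Defensive.

Import Order.TTheory GRing.Theory Num.Theory.
Import numFieldNormedType.Exports.
Local Open Scope classical_set_scope.
Local Open Scope ring_scope.

Definition separable (T : topologicalType) : Prop :=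
  exists S : set T, countable S /\ dense S.

(* The library norm on 'rV[R]_d is the sup norm, hence this definition. *)
Definition enorm (R : realType) (d : nat) (x : 'rV[R]_d) : R :=
  Num.sqrt (\sum_(i < d) x 0 i ^+ 2).

(* The index set {+1, -1, ..., +d1, -d1}: (true, i) stands for i+1 and
   (false, i) for -(i+1). *)
Definition sidx (d1 : nat) : finType := (bool * 'I_d1)%type.

Definition sidx_opp (d1 : nat) (k : sidx d1) : sidx d1 := (~~ k.1, k.2).

Section Differences.
Variables (R : realType) (d : nat).
Implicit Types (u : R -> 'rV[R]_d -> R) (t eta h : R) (m x : 'rV[R]_d).

Definition delta eta m u t x : R := (u t (x + eta *: m) - u t x) / eta.

Definition Delta h m u t x : R :=
  (u t (x + h *: m) - 2 * u t x + u t (x - h *: m)) / h ^+ 2.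

Definition tauT (tau T t : R) : R := Num.min tau (T - t).

(* The denominator is tau, also when the time step is truncated at T. *)
Definition deltaT (tau T : R) u t x : R :=
  (u (t + tauT tau T t) x - u t x) / tau.

End Differences.

Section Mesh.
Variables (R : realType) (d d1 : nat).
Variables (tau h T : R) (ell : sidx d1 -> 'rV[R]_d).

Definition mesh : set (R * 'rV[R]_d) :=
  [set p | exists (j : nat) (i : 'I_d1 -> int),
     p = (Num.min (j%:R * tau) T,
          h *: (\sum_(k < d1) (i k)%:~R *: ell (true, k)))].

Definition mesh_eps (eps : R) (l : 'rV[R]_d) : set (R * 'rV[R]_d) :=
  [set p | exists (q : R * 'rV[R]_d) (i : int),
     mesh q /\ p = (q.1, q.2 + (i%:~R * eps) *: l)].

Variable Q : set (R * 'rV[R]_d).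

Definition Qprime : set (R * 'rV[R]_d) := [set p | Q p /\ 0 <= p.1 < T].

Definition Qint (eps : R) (l : 'rV[R]_d) : set (R * 'rV[R]_d) :=
  [set p | [/\ Qprime p,
     Q (p.1 + tauT tau T p.1, p.2),
     (forall k : 'I_d1, Q (p.1, p.2 + h *: ell (true, k)) /\
                        Q (p.1, p.2 - h *: ell (true, k))),
     Q (p.1, p.2 + eps *: l) &
     Q (p.1, p.2 - eps *: l)]].

Definition Qbdry (eps : R) (l : 'rV[R]_d) : set (R * 'rV[R]_d) :=
  Q `\` Qint eps l.

End Mesh.

Section Equation.
Variables (R : realType) (d d1 : nat) (A : Type).
Variables (tau h T : R) (ell : sidx d1 -> 'rV[R]_d).
Variables (sigma b : A -> sidx d1 -> R -> 'rV[R]_d -> R).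
Variables (c f : A -> R -> 'rV[R]_d -> R).

Definition acoef (alpha : A) (k : sidx d1) (t : R) (x : 'rV[R]_d) : R :=
  2^-1 * sigma alpha k t x ^+ 2.

(* The supremum is taken in \bar R, so that the equation below also asserts
   that it is finite. *)
Definition bellman (u : R -> 'rV[R]_d -> R) (t : R) (x : 'rV[R]_d) : \bar R :=
  ereal_sup (range (fun alpha : A =>
    (\sum_(k : sidx d1) acoef alpha k t x * Delta h (ell k) u t x
     + \sum_(k : sidx d1) b alpha k t x * delta h (ell k) u t x
     - c alpha t x * u t x + f alpha t x)%:E)).

Definition solves (Q : set (R * 'rV[R]_d)) (u : R -> 'rV[R]_d -> R) : Prop :=
  forall p, Qprime T Q p ->
    ((deltaT tau T u p.1 p.2)%:E + bellman u p.1 p.2 = 0)%E.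

End Equation.

Section CoefficientBounds.
Variables (R : realType) (d d1 : nat).
Variables (K h eps : R) (ell : sidx d1 -> 'rV[R]_d) (l : 'rV[R]_d).

Definition lip_bound (psi : R -> 'rV[R]_d -> R) (t : R) (x : 'rV[R]_d) : Prop :=
  [/\ `|psi t x| <= K,
      (forall j : sidx d1, `|delta h (ell j) psi t x| <= K),
      `|delta eps l psi t x| <= K &
      `|delta eps (- l) psi t x| <= K].

Definition diffusion_bound (a : R -> 'rV[R]_d -> R) (t : R) (x : 'rV[R]_d)
    : Prop :=
  let B := K * Num.sqrt (a t x) + K * h in
  [/\ 0 <= a t x <= K,
      (forall j : sidx d1, `|delta h (ell j) a t x| <= B),
      `|delta eps l a t x| <= B &
      `|delta eps (- l) a t x| <= B].

End CoefficientBounds.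

Definition supnorm (R : realType) (d : nat) (Q : set (R * 'rV[R]_d))
    (u : R -> 'rV[R]_d -> R) : R :=
  sup [set `|u p.1 p.2| | p in Q].

(* The maximum over the finite set Qbdry is rendered as a supremum; Qbdry is
   nonempty whenever Q is nonempty and finite and eps *: l != 0.  The inner
   maximum is over nonnegative numbers, so 0 is a neutral default. *)
Definition bdry_max (R : realType) (d d1 : nat) (tau h T : R)
    (ell : sidx d1 -> 'rV[R]_d) (Q : set (R * 'rV[R]_d)) (eps : R)
    (l : 'rV[R]_d) (u : R -> 'rV[R]_d -> R) : R :=
  sup [set \big[Num.max/0]_(k : sidx d1) `|delta h (ell k) u p.1 p.2|
           + `|delta eps l u p.1 p.2| + `|delta eps (- l) u p.1 p.2|
      | p in Qbdry tau h T ell Q eps l].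

(* Main.v *)
Require Import Defs.
From HB Require Import structures.
From mathcomp Require Import all_boot all_order all_algebra.
From mathcomp Require Import all_classical all_reals all_analysis.
From mathcomp Require Import ring lra.

Set Implicit Arguments.
Unset Strict Implicit.
Unset Printing Implicit Defensive.

Import Order.TTheory GRing.Theory Num.Theory.
Import numFieldNormedType.Exports.
Local Open Scope classical_set_scope.
Local Open Scope ring_scope.

(** Bernstein's method on the grid.  Let [w_r] be the negative part of the
    difference quotient of [u] in direction [r], where [r] runs over the
    directions [ell k] (step [h]) and [l], [- l] (step [eps]), and consider a
    maximum point over [Q] of [V = time_weight ^ 2 * \sum_r w_r ^ 2].  Since the
    positive part in direction [r] at [x] is the negative part in the opposite
    direction at the shifted point, a bound on [V] controls all the quotients.
    On the boundary there is nothing to prove.  At an interior point, take a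
    near-optimal control, difference the equation in each direction [r],
    multiply by [w_r] and sum.  Maximality makes the main terms nonnegative
    and leaves the squares [a_k * (delta_k w_r) ^ 2]; these absorb the terms
    [(delta_r a_k) * Delta_k u], because [Delta_k u] is itself a sum of two first
    differences of the [w_r].  What remains is at most a constant times
    [\sum_r w_r ^ 2], which the hypothesis on [lambda] and [c0] dominates. *)

(** * Summed inequalities for the diffusion, drift and time terms *)

Lemma young_le (R : realFieldType) (g x y : R) : 0 < g ->
  x * y <= g * x ^+ 2 / 4 + y ^+ 2 / g.
Proof.
move=> g0; rewrite -subr_ge0.
have -> : g * x ^+ 2 / 4 + y ^+ 2 / g - x * y = (g * x / 2 - y) ^+ 2 / g.
  by field; rewrite gt_eqF.
by rewrite divr_ge0 ?sqr_ge0 // ltW.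
Qed.

Lemma normr_sub_le (R : realDomainType) (m x y : R) :
  0 <= x <= m -> 0 <= y <= m -> `|x - y| <= m.
Proof. by move=> /andP[? ?] /andP[? ?]; rewrite ler_norml; lra. Qed.

(* [w], [p], [q] are the negative parts at [x], [x + h * ell k], [x - h * ell k],
   [s ^+ 2 + eta r * da r] is [a_k] at the point shifted in direction [r], and
   [X] is [Delta_k u x] as given by [Delta_negp]. *)
Lemma diffusion_sum_ge (R : realFieldType) (I : finType) (i1 i2 : I)
    (K h s m X : R) (w p q da eta : I -> R) :
  let n := #|I|%:R in
  1 <= K -> 0 < h -> 0 <= s ->
  (forall r, 0 <= w r <= m) ->
  (forall r, 0 <= p r <= m) ->
  (forall r, 0 <= q r <= m) ->
  \sum_r p r ^+ 2 <= \sum_r w r ^+ 2 ->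
  \sum_r q r ^+ 2 <= \sum_r w r ^+ 2 ->
  (forall r, 0 <= eta r <= K * h) ->
  (forall r, `|da r| <= K * s + K * h) ->
  X = ((p i1 - w i1) + (q i2 - w i2)) / h ->
  - (n * (2 * K ^+ 4 + 2 * K ^+ 2 + 2 * n * K ^+ 2 + 2 * K) * m ^+ 2) <=
  \sum_r w r * (- ((s ^+ 2 + eta r * da r) * ((p r + q r - 2 * w r) / h ^+ 2))
                + da r * X).
Proof.
move=> n K1 h0 s0 wm pm qm Sp Sq etah dah XE.
have n1 : 1 <= n.
  by rewrite ler1n lt0n; apply/eqP => /card0_eq /(_ i1).
have K0 : 0 < K by lra.
pose P r := (p r - w r) / h; pose Q r := (q r - w r) / h.
pose C : R := 2 * K ^+ 4 + 2 * K ^+ 2 + 2 * n * K ^+ 2 + 2 * K.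
have hE (f : I -> R) r : h * `|(f r - w r) / h| = `|f r - w r|.
  by rewrite normrM normfV (gtr0_norm h0) mulrC divfK // gt_eqF.
(* All coefficient errors have the shape [c * (s + h) * w * |F|]. Young's inequality trades the part
   with [s] for a fraction of the square [(s * F) ^+ 2]; the part with [h] needs no square, since
   [h * F] is a difference of two values in [[0, m]]. *)
have err (g c : R) (f : I -> R) r r' : 0 < g -> 0 <= c ->
    (forall r, 0 <= f r <= m) ->
    c * (s + h) * w r * `|(f r' - w r') / h| <=
    g * (s ^+ 2 * ((f r' - w r') / h) ^+ 2) / 4
      + (c ^+ 2 / g + c) * m ^+ 2.
  move=> g0 c0 fm; set F := (f r' - w r') / h.
  have hF : h * `|F| <= m by rewrite hE; exact: normr_sub_le.
  have /andP[w0 wle] := wm r.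
  have m0 : 0 <= m by exact: le_trans wle.
  have := young_le (s * `|F|) (c * w r) g0.
  rewrite [(s * _) ^+ 2]exprMn real_normK ?num_real // [(c * _) ^+ 2]exprMn => Y.
  have w2 : w r ^+ 2 <= m ^+ 2 by rewrite ler_sqr ?nnegrE.
  have A1 : c * (w r * (h * `|F|)) <= c * m ^+ 2.
    by rewrite ler_wpM2l // expr2 ler_pM // mulr_ge0 // ltW.
  have A2 : c ^+ 2 / g * w r ^+ 2 <= c ^+ 2 / g * m ^+ 2.
    by rewrite ler_wpM2l // divr_ge0 ?sqr_ge0 // ltW.
  rewrite [c ^+ 2 * w r ^+ 2 / g]mulrAC in Y.
  lra.
have term r : s ^+ 2 / (2 * h ^+ 2) * (2 * w r ^+ 2 - p r ^+ 2 - q r ^+ 2)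
     + s ^+ 2 / 4 * (P r ^+ 2 + Q r ^+ 2)
     - s ^+ 2 / (4 * n) * (P i1 ^+ 2 + Q i2 ^+ 2) - C * m ^+ 2 <=
   w r * (- ((s ^+ 2 + eta r * da r) * ((p r + q r - 2 * w r) / h ^+ 2))
                + da r * X).
  have /andP[w0 _] := wm r; have /andP[e0 ele] := etah r.
  (* The identity [2 * w * (w - p) = w ^+ 2 - p ^+ 2 + (p - w) ^+ 2] separates a part that
     maximality makes nonnegative after summation from the squares that absorb errors. *)
  have -> : w r * (- ((s ^+ 2 + eta r * da r) * ((p r + q r - 2 * w r) / h ^+ 2))
                + da r * X) =
    s ^+ 2 / (2 * h ^+ 2) * (2 * w r ^+ 2 - p r ^+ 2 - q r ^+ 2)
     + s ^+ 2 / 2 * (P r ^+ 2 + Q r ^+ 2)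
     - da r * (eta r / h * w r * (P r + Q r))
     + da r * (w r * (P i1 + Q i2)).
    by rewrite XE /P /Q; field; rewrite gt_eqF.
  have B1 : `|da r * (eta r / h * w r * (P r + Q r))| <=
      K ^+ 2 * (s + h) * w r * `|P r| + K ^+ 2 * (s + h) * w r * `|Q r|.
    rewrite -mulrDr normrM [K ^+ 2 * _ * _ * _](_ : _ =
      (K * s + K * h) * (K * w r * (`|P r| + `|Q r|))); last by ring.
    apply: ler_pM => //; rewrite normrM; apply: ler_pM => //; last exact: ler_normD.
    rewrite normrM (ger0_norm w0); apply: ler_wpM2r => //.
    by rewrite ger0_norm ?ler_pdivrMr // divr_ge0 // ltW.
  have B2 : `|da r * (w r * (P i1 + Q i2))| <=
      K * (s + h) * w r * `|P i1| + K * (s + h) * w r * `|Q i2|.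
    rewrite -mulrDr normrM [K * _ * _ * _](_ : _ =
      (K * s + K * h) * (w r * (`|P i1| + `|Q i2|))); last by ring.
    apply: ler_pM => //; rewrite normrM (ger0_norm w0); apply: ler_wpM2l => //.
    exact: ler_normD.
  (* Weight [1] spends half of the available squares in direction [r]. The squares at [i1] and [i2]
     recur for every [r]; with weight [n^-1] their [n] copies cost no more than the other half of
     the summed squares. *)
  have n0 : 0 < n^-1 by rewrite invr_gt0; lra.
  have E1 := err 1 (K ^+ 2) p r r ltr01 (sqr_ge0 K) pm.
  have E2 := err 1 (K ^+ 2) q r r ltr01 (sqr_ge0 K) qm.
  have E3 := err n^-1 K p r i1 n0 (ltW K0) pm.
  have E4 := err n^-1 K q r i2 n0 (ltW K0) qm.
  move: B1 B2 E1 E2 E3 E4; rewrite -/(P r) -/(Q r) -/(P i1) -/(Q i2).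
  rewrite !ler_norml => /andP[_ B1] /andP[B2 _].
  rewrite !divr1 !mul1r !invrK invfM /C -exprM => E1 E2 E3 E4.
  lra.
have S4 (y : R) : \sum_(r : I) y = n * y.
  by rewrite sumr_const -[LHS]mulr_natl.
apply: le_trans (ler_sum _ (fun r _ => term r)).
rewrite !sumrB !big_split /= -!mulr_sumr !sumrB -mulr_sumr big_split /= !S4.
have PQ f r : 0 <= \sum_(i : I) ((f i - w i) / h) ^+ 2 - ((f r - w r) / h) ^+ 2.
  rewrite subr_ge0 (bigD1 r) //= lerDl sumr_ge0 // => i _; exact: sqr_ge0.
have s4 : 0 <= s ^+ 2 / 4 by rewrite divr_ge0 ?sqr_ge0.
have := mulr_ge0 s4 (PQ p i1); have := mulr_ge0 s4 (PQ q i2).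
have s2 : 0 <= s ^+ 2 / (2 * h ^+ 2).
  by rewrite divr_ge0 ?sqr_ge0 // mulr_ge0 // sqr_ge0.
have SS : 0 <= 2 * \sum_r w r ^+ 2 - \sum_r p r ^+ 2 - \sum_r q r ^+ 2 by lra.
have := mulr_ge0 s2 SS.
rewrite -/(P i1) -/(Q i2) [s ^+ 2 / (4 * n) * _](_ : _ =
   s ^+ 2 / 4 * (P i1 ^+ 2 + Q i2 ^+ 2)); last by field; rewrite gt_eqF //; lra.
rewrite /P /Q /C; lra.
Qed.

(** No square has to be spent here: [eta r / h <= K], so the variation of [b] over one step
    multiplies a difference already bounded by [m], while [b] itself contributes [w ^+ 2 - p ^+ 2],
    nonnegative in the sum. *)
Lemma drift_sum_ge (R : realFieldType) (I : finType) (K h b m D : R)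
    (w p db eta : I -> R) :
  1 <= K -> 0 < h -> 0 <= b ->
  (forall r, 0 <= w r <= m) ->
  (forall r, 0 <= p r <= m) ->
  \sum_r p r ^+ 2 <= \sum_r w r ^+ 2 ->
  (forall r, 0 <= eta r <= K * h) ->
  (forall r, `|db r| <= K) ->
  `|D| <= m ->
  - (#|I|%:R * (K ^+ 2 + K) * m ^+ 2) <=
  \sum_r w r * (- ((b + eta r * db r) * ((p r - w r) / h)) + db r * D).
Proof.
move=> K1 h0 b0 wm pm Sp etah dbh Dm.
have term r : b / (2 * h) * (w r ^+ 2 - p r ^+ 2) - (K ^+ 2 + K) * m ^+ 2 <=
   w r * (- ((b + eta r * db r) * ((p r - w r) / h)) + db r * D).
  have /andP[w0 wle] := wm r; have /andP[e0 ele] := etah r.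
  have m0 : 0 <= m by exact: le_trans wle.
  have -> : w r * (- ((b + eta r * db r) * ((p r - w r) / h)) + db r * D) =
    b / (2 * h) * (w r ^+ 2 - p r ^+ 2) + b / (2 * h) * (p r - w r) ^+ 2
    - db r * (eta r / h * (w r * (p r - w r))) + db r * (w r * D).
    by field; rewrite gt_eqF.
  have B0 : 0 <= b / (2 * h) * (p r - w r) ^+ 2.
    by rewrite mulr_ge0 ?sqr_ge0 // divr_ge0 // mulr_ge0 // ltW.
  have B1 : `|db r * (eta r / h * (w r * (p r - w r)))| <= K * (K * (m * m)).
    rewrite normrM; apply: ler_pM => //; rewrite normrM; apply: ler_pM => //.
      by rewrite ger0_norm ?ler_pdivrMr // divr_ge0 // ltW.
    rewrite normrM (ger0_norm w0); apply: ler_pM => //; exact: normr_sub_le.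
  have B2 : `|db r * (w r * D)| <= K * (m * m).
    rewrite normrM; apply: ler_pM => //.
    by rewrite normrM (ger0_norm w0); apply: ler_pM.
  move: B1 B2; rewrite !ler_norml => /andP[_ B1] /andP[B2 _].
  lra.
apply: le_trans (ler_sum _ (fun r _ => term r)).
rewrite sumrB -mulr_sumr sumrB sumr_const -[X in _ - X]mulr_natl.
have b2 : 0 <= b / (2 * h) by rewrite divr_ge0 // mulr_ge0 // ltW.
have : 0 <= \sum_r w r ^+ 2 - \sum_r p r ^+ 2 by lra.
by move=> /(mulr_ge0 b2); lra.
Qed.

(** Young's inequality in the form [w * p <= rho / 2 * w ^+ 2 + p ^+ 2 / (2 * rho)]: under the
    hypothesis each half costs [rho / 2]. This turns growth of the time weight into the coercive
    term [(1 - rho) / tau]. *)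
Lemma decay_sum_ge (R : realFieldType) (I : finType) (rho : R) (w p : I -> R) :
  0 < rho -> \sum_r p r ^+ 2 <= rho ^+ 2 * \sum_r w r ^+ 2 ->
  (1 - rho) * \sum_r w r ^+ 2 <= \sum_r w r * (w r - p r).
Proof.
move=> rho0 pw.
have term r : (1 - rho / 2) * w r ^+ 2 - (2 * rho)^-1 * p r ^+ 2 <=
    w r * (w r - p r).
  rewrite -subr_ge0 [X in 0 <= X](_ : _ = (rho * w r - p r) ^+ 2 / (2 * rho)).
    by rewrite divr_ge0 ?sqr_ge0 // mulr_ge0 // ltW.
  by field; rewrite gt_eqF.
apply: le_trans (ler_sum _ (fun r _ => term r)).
rewrite sumrB -!mulr_sumr.
have : 0 <= (2 * rho)^-1 by rewrite invr_ge0 mulr_ge0 // ltW.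
move: pw; rewrite -subr_ge0 => pw /mulr_ge0 /(_ pw).
rewrite mulrBr [X in X - _](_ : _ = rho / 2 * \sum_r w r ^+ 2); first lra.
by field; rewrite gt_eqF.
Qed.

(** * Directions [ell k] ([inl]) and [l], [- l] ([inr]), negative parts, difference quotients *)

Definition gidx (d1 : nat) : finType := (sidx d1 + bool)%type.

Definition gidx_opp (d1 : nat) (r : gidx d1) : gidx d1 :=
  match r with inl k => inl (sidx_opp k) | inr s => inr (~~ s) end.

Definition negp (R : realDomainType) (y : R) : R := Num.max 0 (- y).

Lemma negp_ge0 (R : realDomainType) (y : R) : 0 <= negp y.
Proof. by rewrite /negp le_max lexx. Qed.

Lemma negp_le_norm (R : realDomainType) (y : R) : negp y <= `|y|.
Proof. by rewrite /negp ge_max normr_ge0 -normrN ler_norm. Qed.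

Lemma ge_negp (R : realDomainType) (y : R) : - negp y <= y.
Proof. by rewrite /negp lerNl le_max lexx orbT. Qed.

Lemma negp_id (R : realDomainType) (y : R) : negp y * y = - negp y * negp y.
Proof. by rewrite /negp; case: leP => _; rewrite ?mul0r ?oppr0 ?mul0r //; ring. Qed.

Lemma negpN (R : realDomainType) (y : R) : negp (- y) - negp y = y.
Proof.
by rewrite /negp opprK; case: (leP 0 y) => ?; case: (leP 0 (- y)) => ?; lra.
Qed.

Lemma normr_negp (R : realDomainType) (m y : R) :
  negp y <= m -> negp (- y) <= m -> `|y| <= m.
Proof.
by rewrite /negp opprK !ge_max ler_norml => /andP[_ ?] /andP[_ ?]; lra.
Qed.

Section Gradient.
Variables (R : realType) (d d1 : nat) (h eps : R).
Variables (ell : sidx d1 -> 'rV[R]_d) (l : 'rV[R]_d).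
Hypothesis ell_opp : forall k, ell k = - ell (sidx_opp k).
Implicit Types (u : R -> 'rV[R]_d -> R) (t : R) (x : 'rV[R]_d).
Implicit Types (k : sidx d1) (r : gidx d1).

Definition gstep r : R := if r is inl _ then h else eps.

Definition gdir r : 'rV[R]_d :=
  match r with inl k => ell k | inr s => if s then l else - l end.

Definition grad u r : R -> 'rV[R]_d -> R := delta (gstep r) (gdir r) u.

Lemma gdir_opp r : gdir (gidx_opp r) = - gdir r.
Proof. by case: r => [k|[]] /=; rewrite ?opprK // [in RHS]ell_opp opprK. Qed.

Lemma grad_opp u r t x :
  grad u (gidx_opp r) t (x + gstep r *: gdir r) = - grad u r t x.
Proof.
rewrite /grad /delta gdir_opp.
have -> : gstep (gidx_opp r) = gstep r by case: r.
by rewrite scalerN addrK -mulNr opprB.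
Qed.

Lemma normr_grad_le u r t x m :
  negp (grad u r t x) <= m ->
  negp (grad u (gidx_opp r) t (x + gstep r *: gdir r)) <= m ->
  `|grad u r t x| <= m.
Proof. by rewrite grad_opp; exact: normr_negp. Qed.

(** The second difference is the sum of the quotients along [ell k] and [- ell k], divided by [h].
    Each quotient is its positive minus its negative part, and the positive part is the negative
    part of the reversed quotient at the neighbour. Thus only increments of [w] occur, the same ones
    whose squares the diffusion term provides. *)
Lemma Delta_negp u k t x :
  let w r y := negp (grad u r t y) in
  let k' := sidx_opp k in
  Delta h (ell k) u t x =
    ((w (inl k') (x + h *: ell k) - w (inl k') x)
     + (w (inl k) (x - h *: ell k) - w (inl k) x)) / h.
Proof.
move=> w k'.
have E1 : w (inl k') (x + h *: ell k) = negp (- grad u (inl k) t x).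
  by rewrite -(grad_opp u (inl k)).
have E2 : w (inl k) (x - h *: ell k) = negp (- grad u (inl k') t x).
  rewrite -(grad_opp u (inl k')) /= [ell k]ell_opp scalerN opprK.
  by rewrite /w /k' /sidx_opp /= negbK -surjective_pairing.
rewrite E1 E2 /w.
have := negpN (grad u (inl k) t x); have := negpN (grad u (inl k') t x).
have -> : Delta h (ell k) u t x = (grad u (inl k) t x + grad u (inl k') t x) / h.
  rewrite /Delta /grad /delta /= /k'.
  have -> : ell (sidx_opp k) = - ell k by rewrite [in RHS]ell_opp opprK.
  by rewrite scalerN -mulrDl -mulrA -invfM -expr2; congr (_ / _); ring.
move=> H1 H2; congr (_ / h); lra.
Qed.

Lemma grad_Delta u r k t x :
  (Delta h (ell k) u t (x + gstep r *: gdir r) - Delta h (ell k) u t x) / gstep r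
  = Delta h (ell k) (grad u r) t x.
Proof.
rewrite /Delta /grad /delta -[x + _ + h *: _]addrAC -[x + _ - h *: _]addrAC.
ring.
Qed.

Lemma grad_delta u r k t x :
  (delta h (ell k) u t (x + gstep r *: gdir r) - delta h (ell k) u t x) / gstep r
  = delta h (ell k) (grad u r) t x.
Proof. by rewrite /grad /delta -[x + _ + h *: _]addrAC; ring. Qed.

(** At the centre the negative part times [v] is exactly minus its square; at the two neighbours [v]
    is at least minus its negative part, and the factor is nonnegative. *)
Lemma negp_Delta_ge (v : R -> 'rV[R]_d -> R) k t x :
  - (negp (v t x) * ((negp (v t (x + h *: ell k)) + negp (v t (x - h *: ell k))
      - 2 * negp (v t x)) / h ^+ 2)) <= negp (v t x) * Delta h (ell k) v t x.
Proof.
rewrite /Delta !mulrA -mulNr ler_wpM2r ?invr_ge0 ?sqr_ge0 //.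
have N0 := negp_ge0 (v t x).
have := ler_wpM2l N0 (ge_negp (v t (x + h *: ell k))).
have := ler_wpM2l N0 (ge_negp (v t (x - h *: ell k))).
have := negp_id (v t x); nra.
Qed.

Lemma negp_delta_ge (v : R -> 'rV[R]_d -> R) k t x : 0 <= h ->
  - (negp (v t x) * ((negp (v t (x + h *: ell k)) - negp (v t x)) / h)) <=
  negp (v t x) * delta h (ell k) v t x.
Proof.
move=> h0; rewrite /delta !mulrA -mulNr ler_wpM2r ?invr_ge0 //.
have N0 := negp_ge0 (v t x).
have := ler_wpM2l N0 (ge_negp (v t (x + h *: ell k))).
have := negp_id (v t x); nra.
Qed.

End Gradient.

(** * Interior estimate at a maximum point *)

Section InteriorEstimate.
Variables (R : realType) (d d1 : nat).

Definition diffusion_const (n K : R) : R :=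
  n * (2 * K ^+ 4 + 2 * K ^+ 2 + 2 * n * K ^+ 2 + 2 * K).

Definition drift_const (n K : R) : R := n * (K ^+ 2 + K).

(** Here [F] is the residual of one fixed control, and the bound [1] on its quotients is the slack
    left by near-optimality. The [+ 1] in the last hypothesis leaves one [m ^+ 2] after the
    diffusion and drift losses are paid; it is compared with terms linear in [m], and dividing by
    [m] gives the bound. *)
Lemma interior_estimate (K h eps tau T lambda rho m U t : R)
    (ell : sidx d1 -> 'rV[R]_d) (l x : 'rV[R]_d)
    (a b : sidx d1 -> R -> 'rV[R]_d -> R) (c f u : R -> 'rV[R]_d -> R) :
  let n := #|gidx d1|%:R in
  let w r s y := negp (grad h eps ell l u r s y) in
  let F y := deltaT tau T u t y
     + (\sum_k a k t y * Delta h (ell k) u t y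
        + \sum_k b k t y * delta h (ell k) u t y - c t y * u t y + f t y) in
  1 <= K -> 0 < h -> 0 < eps <= K * h -> 0 < tau -> 0 < rho -> 0 < m ->
  (forall k, ell k = - ell (sidx_opp k)) ->
  (forall k y, 0 <= a k t y) -> (forall k y, 0 <= b k t y) ->
  (forall y, lambda <= c t y) ->
  (forall k, lip_bound K h eps ell l (b k) t x) ->
  lip_bound K h eps ell l (fun t x => c t x - lambda) t x ->
  lip_bound K h eps ell l f t x ->
  (forall k, diffusion_bound K h eps ell l (a k) t x) ->
  \sum_r w r t x ^+ 2 = m ^+ 2 ->
  (forall k, \sum_r w r t (x + h *: ell k) ^+ 2 <= m ^+ 2) ->
  \sum_r w r (t + tauT tau T t) x ^+ 2 <= rho ^+ 2 * m ^+ 2 ->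
  (forall r, (F (x + gstep h eps r *: gdir ell l r) - F x) / gstep h eps r <= 1) ->
  `|u t x| <= U ->
  #|sidx d1|%:R * (diffusion_const n K + drift_const n K) + 1
    <= lambda + (1 - rho) / tau ->
  m <= n * (K * U + K + 1).
Proof.
move=> n w F K1 h0 /andP[e0 eKh] tau0 rho0 m0 ellN a0 b0 clam bL cL fL aD
  Sx Sk St FD uU big.
set y := fun r => x + gstep h eps r *: gdir ell l r.
have eta0 (r : gidx d1) : 0 < gstep h eps r by case: r.
have etaK (r : gidx d1) : 0 <= gstep h eps r <= K * h.
  by rewrite (ltW (eta0 r)) /=; case: r => [k|s] //=; nra.
have lipD psi r : lip_bound K h eps ell l psi t x ->
    `|(psi t (y r) - psi t x) / gstep h eps r| <= K.
  by case=> _ H1 H2 H3; case: r => [k|[]]; [exact: H1|exact: H2|exact: H3].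
have diffD k r : `|(a k t (y r) - a k t x) / gstep h eps r|
    <= K * Num.sqrt (a k t x) + K * h.
  by case: (aD k) => _ H1 H2 H3; case: r => [j|[]]; [exact: H1|exact: H2|exact: H3].
have wm z s r : \sum_r w r s z ^+ 2 <= m ^+ 2 -> 0 <= w r s z <= m.
  move=> H; rewrite negp_ge0 /= -ler_sqr ?nnegrE ?negp_ge0 ?(ltW m0) //.
  apply: le_trans H; rewrite (bigD1 r) //= lerDl.
  by apply: sumr_ge0 => i _; exact: sqr_ge0.
have kN k : h *: ell (sidx_opp k) = - (h *: ell k).
  by rewrite -scalerN [in RHS]ellN opprK.
have Sk' k : \sum_r w r t (x - h *: ell k) ^+ 2 <= m ^+ 2 by rewrite -kN.
have Sx' : \sum_r w r t x ^+ 2 <= m ^+ 2 by rewrite Sx.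
pose v r := grad h eps ell l u r.
pose da k r := (a k t (y r) - a k t x) / gstep h eps r.
pose db k r := (b k t (y r) - b k t x) / gstep h eps r.
pose eta (r : gidx d1) := gstep h eps r.
pose DA k r := w r t x * (- ((Num.sqrt (a k t x) ^+ 2 + eta r * da k r) *
    ((w r t (x + h *: ell k) + w r t (x - h *: ell k) - 2 * w r t x) / h ^+ 2))
    + da k r * Delta h (ell k) u t x).
pose DB k r := w r t x * (- ((b k t x + eta r * db k r) *
    ((w r t (x + h *: ell k) - w r t x) / h))
    + db k r * delta h (ell k) u t x).
pose DT r := w r t x * (w r t x - w r (t + tauT tau T t) x).
have KU : 0 <= K * U by apply: mulr_ge0; [lra|exact: le_trans uU].
have vw r : w r t x * v r t x = - w r t x * w r t x by exact: negp_id.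
have key r : DT r / tau + \sum_k DA k r + \sum_k DB k r
    + lambda * w r t x ^+ 2 <= (K * U + K + 1) * m.
  have [w0 wle] : 0 <= w r t x /\ w r t x <= m by apply/andP/wm.
  pose dc := (c t (y r) - c t x) / eta r.
  pose df := (f t (y r) - f t x) / eta r.
  (* Discrete product rule: the coefficient at the shifted point multiplies the difference of [v r],
     and the quotient of the coefficient multiplies the difference of [u] at [x]. *)
  have FE : (F (y r) - F x) / eta r =
     (v r (t + tauT tau T t) x - v r t x) / tau
     + \sum_k (a k t (y r) * Delta h (ell k) (v r) t x
               + da k r * Delta h (ell k) u t x)
     + \sum_k (b k t (y r) * delta h (ell k) (v r) t x
               + db k r * delta h (ell k) u t x)
     - (c t (y r) * v r t x + dc * u t x) + df.
    have Ea : (\sum_k a k t (y r) * Delta h (ell k) u t (y r)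
        - \sum_k a k t x * Delta h (ell k) u t x) / eta r =
        \sum_k (a k t (y r) * Delta h (ell k) (v r) t x
               + da k r * Delta h (ell k) u t x).
      rewrite -sumrB mulr_suml; apply: eq_bigr => k _.
      by rewrite -grad_Delta /da /y /eta; ring.
    have Eb : (\sum_k b k t (y r) * delta h (ell k) u t (y r)
        - \sum_k b k t x * delta h (ell k) u t x) / eta r =
        \sum_k (b k t (y r) * delta h (ell k) (v r) t x
               + db k r * delta h (ell k) u t x).
      rewrite -sumrB mulr_suml; apply: eq_bigr => k _.
      by rewrite -grad_delta /db /y /eta; ring.
    have vE s : v r s x = (u s (y r) - u s x) / eta r by [].
    by rewrite -Ea -Eb !vE /F /deltaT /dc /df; ring.
  have HT : DT r / tau <= w r t x * ((v r (t + tauT tau T t) x - v r t x) / tau).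
    rewrite /DT -!mulrA; rewrite !mulrA ler_wpM2r ?invr_ge0 ?(ltW tau0) //.
    have : w r t x * - w r (t + tauT tau T t) x <=
        w r t x * v r (t + tauT tau T t) x.
      by apply: ler_wpM2l => //; exact: ge_negp.
    by move: (vw r); lra.
  have HA k : DA k r <= w r t x * (a k t (y r) * Delta h (ell k) (v r) t x
               + da k r * Delta h (ell k) u t x).
    have aE : Num.sqrt (a k t x) ^+ 2 + eta r * da k r = a k t (y r).
      by rewrite sqr_sqrtr // /da mulrC divfK ?gt_eqF // addrC subrK.
    rewrite /DA aE !mulrDr lerD2r.
    have H : - (w r t x * ((w r t (x + h *: ell k) + w r t (x - h *: ell k)
        - 2 * w r t x) / h ^+ 2)) <= w r t x * Delta h (ell k) (v r) t x.
      exact: negp_Delta_ge.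
    by have := ler_wpM2l (a0 k (y r)) H; lra.
  have HB k : DB k r <= w r t x * (b k t (y r) * delta h (ell k) (v r) t x
               + db k r * delta h (ell k) u t x).
    have bE : b k t x + eta r * db k r = b k t (y r).
      by rewrite /db mulrC divfK ?gt_eqF // addrC subrK.
    rewrite /DB bE !mulrDr lerD2r.
    have H : - (w r t x * ((w r t (x + h *: ell k) - w r t x) / h)) <=
        w r t x * delta h (ell k) (v r) t x by exact: negp_delta_ge (ltW h0).
    by have := ler_wpM2l (b0 k (y r)) H; lra.
  (* Subtracting the constant [lambda] does not change the quotient, so the bound is independent of
     [lambda]. *)
  have dcK : `|dc| <= K.
    rewrite /dc [X in X / _](_ : _ = (c t (y r) - lambda) - (c t x - lambda)).
      exact: lipD cL.
    by ring.
  have dfK : `|df| <= K by exact: lipD fL.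
  have Hc : w r t x * (dc * u t x) <= w r t x * (K * U).
    apply: le_trans (ler_norm _) _; rewrite normrM (ger0_norm w0).
    by apply: ler_wpM2l => //; rewrite (normrM dc (u t x)); exact: ler_pM.
  have Hf : - (w r t x * df) <= w r t x * K.
    apply: le_trans (ler_norm _) _; rewrite normrN normrM (ger0_norm w0).
    exact: ler_wpM2l.
  have Hl : lambda * w r t x ^+ 2 <= - (w r t x * (c t (y r) * v r t x)).
    have := ler_wpM2r (sqr_ge0 (w r t x)) (clam (y r)).
    by rewrite [w r t x * (_ * _)]mulrCA vw; lra.
  have := ler_wpM2l w0 (FD r); rewrite -/(y r) -/(eta r) FE.
  have : \sum_k DA k r <= w r t x * \sum_k
      (a k t (y r) * Delta h (ell k) (v r) t x + da k r * Delta h (ell k) u t x).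
    by rewrite mulr_sumr; apply: ler_sum.
  have : \sum_k DB k r <= w r t x * \sum_k
      (b k t (y r) * delta h (ell k) (v r) t x + db k r * delta h (ell k) u t x).
    by rewrite mulr_sumr; apply: ler_sum.
  have : (K * U + K + 1) * w r t x <= (K * U + K + 1) * m.
    by apply: ler_wpM2l => //; lra.
  have := Hc; lra.
have sumS (z : R) : \sum_(r : gidx d1) z = n * z.
  by rewrite sumr_const -[LHS]mulr_natl.
have sumJ (z : R) : \sum_(r : sidx d1) z = #|sidx d1|%:R * z.
  by rewrite sumr_const -[LHS]mulr_natl.
(* The sums are exchanged because, for fixed [k], the squares in all directions [r] are needed
   together to absorb the errors. *)
have tot : (\sum_r DT r) / tau + \sum_k \sum_r DA k r + \sum_k \sum_r DB k r
    + lambda * m ^+ 2 <= n * ((K * U + K + 1) * m).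
  rewrite -Sx mulr_suml mulr_sumr exchange_big [X in _ + X + _]exchange_big /=.
  by rewrite -!big_split -sumS /=; apply: ler_sum => r _; exact: key.
have HT : (1 - rho) * m ^+ 2 <= \sum_r DT r.
  by rewrite -Sx; apply: decay_sum_ge; rewrite ?Sx.
have HA k : - (diffusion_const n K * m ^+ 2) <= \sum_r DA k r.
  apply: (@diffusion_sum_ge _ _ (inl (sidx_opp k)) (inl k)) => //.
  - by move=> r; exact: wm.
  - by move=> r; exact: wm.
  - by move=> r; exact: wm.
  - by rewrite Sx.
  - by rewrite Sx.
  - exact: diffD.
  - by rewrite (Delta_negp h eps l ellN).
have HB k : - (drift_const n K * m ^+ 2) <= \sum_r DB k r.
  apply: drift_sum_ge => //.
  - by move=> r; exact: wm.
  - by move=> r; exact: wm.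
  - by rewrite Sx.
  - by move=> r; exact: lipD.
  (* The positive part of the quotient along [ell k] is a negative part at [x + h *: ell k], where
     the sum of squares is also at most [m ^+ 2]. *)
  - apply: (normr_grad_le (eps := eps) (l := l) ellN (r := inl k)).
      by have /andP[] := wm x t (inl k) Sx'.
    by have /andP[] := wm _ t (inl (sidx_opp k)) (Sk k).
have tA : #|sidx d1|%:R * - (diffusion_const n K * m ^+ 2)
    <= \sum_k \sum_r DA k r by rewrite -sumJ; exact: ler_sum.
have tB : #|sidx d1|%:R * - (drift_const n K * m ^+ 2)
    <= \sum_k \sum_r DB k r by rewrite -sumJ; exact: ler_sum.
have tT : (1 - rho) * m ^+ 2 / tau <= (\sum_r DT r) / tau.
  by rewrite ler_pM2r // invr_gt0.
have m2 : 0 <= m ^+ 2 by exact: sqr_ge0.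
have := ler_wpM2r m2 big => tb.
rewrite -(ler_pM2r m0) -expr2.
lra.
Qed.

End InteriorEstimate.

(** * Maxima and suprema over finite sets *)

Lemma finite_set_argmax (T : eqType) (R : realDomainType) (A : set T)
    (F : T -> R) :
  finite_set A -> A !=set0 -> exists2 p, A p & forall q, A q -> F q <= F p.
Proof.
move=> /finite_seqP[s ->]; elim: s => [[x]//|x s IH] _.
have [->|] := eqVneq s [::].
  exists x => [|q]; first by rewrite /= mem_head.
  by rewrite /= inE => /eqP ->.
move=> s0; have /IH[p sp pmax] : [set` s]%classic !=set0.
  by case: s s0 {IH} => // y s _; exists y; rewrite /= mem_head.
have [xp|px] := leP (F x) (F p).
  exists p => [|q]; first by rewrite /= inE [p \in s]sp orbT.
  by rewrite /= inE => /orP[/eqP ->|/pmax].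
exists x => [|q]; first by rewrite /= mem_head.
rewrite /= inE => /orP[/eqP -> //|/pmax /le_trans]; apply; exact: ltW.
Qed.

Lemma le_sup_finite (T : eqType) (R : realType) (A : set T) (F : T -> R) p :
  finite_set A -> A p -> F p <= sup [set F q | q in A].
Proof.
move=> Afin Ap.
have [p0 _ p0max] := finite_set_argmax F Afin (ex_intro _ p Ap).
apply: ub_le_sup; last by exists p.
by exists (F p0) => _ [q Aq <-]; exact: p0max.
Qed.

Lemma sup_finite_ge0 (T : eqType) (R : realType) (A : set T) (F : T -> R) :
  finite_set A -> (forall p, A p -> 0 <= F p) -> 0 <= sup [set F q | q in A].
Proof.
(* The empty set is harmless: its supremum is [0] by convention. *)
move=> Afin F0; have [->|/set0P[p Ap]] := eqVneq A set0.
  by rewrite image_set0 sup0.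
exact: le_trans (F0 _ Ap) (le_sup_finite F Afin Ap).
Qed.

(** * Exponential time weight *)

(* Constant on each time layer [((j - 1) * tau, j * tau]], so that it gains the
   full factor [expR (c0 * tau)] also over the truncated step ending at [T]. *)
Definition time_weight (R : realType) (c0 tau t : R) : R :=
  expR (c0 * tau * (Num.ceil (t / tau))%:~R).

Lemma time_weight_ge1 (R : realType) (c0 tau t : R) :
  0 <= c0 -> 0 < tau -> 0 <= t -> 1 <= time_weight c0 tau t.
Proof.
move=> c00 tau0 t0; rewrite -expR0 ler_expR.
rewrite mulr_ge0 ?mulr_ge0 ?(ltW tau0) // ler0z ceil_ge0.
by apply: lt_le_trans (divr_ge0 t0 (ltW tau0)); rewrite ltrN10.
Qed.

(** The ceiling exceeds [t / tau] by less than one, which accounts for the extra [tau] in the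
    exponent. *)
Lemma time_weight_le (R : realType) (c0 tau T t : R) :
  0 <= c0 -> 0 < tau -> t <= T -> time_weight c0 tau t <= expR (c0 * (T + tau)).
Proof.
move=> c00 tau0 tT; rewrite ler_expR -mulrA ler_wpM2l //.
have /andP[+ _] := ceil_itv (t / tau).
rewrite intrB ltrBlDr -(ltr_pM2l tau0) mulrDr mulrCA divff ?gt_eqF // !mulr1.
by move=> H; lra.
Qed.

Lemma time_weight_step (R : realType) (c0 tau T : R) (j : nat) :
  0 < tau -> j%:R * tau < T ->
  time_weight c0 tau (j%:R * tau) =
  expR (- (c0 * tau)) * time_weight c0 tau (j%:R * tau + tauT tau T (j%:R * tau)).
Proof.
move=> tau0 jT; rewrite -expRD; congr expR.
rewrite mulfK ?gt_eqF // (_ : Num.ceil _ = Posz j); last first.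
  by apply: ceil_def; rewrite intrB lexx andbT ltrBlDr ltrDl.
(* Even when truncated, the next time lies in [(j * tau, (j + 1) * tau]], so the ceiling rises by
   exactly one. *)
rewrite (_ : Num.ceil _ = Posz j.+1); last first.
  apply: ceil_def; rewrite ltr_pdivlMr // ler_pdivrMr //.
  have -> : (Posz j.+1 - 1)%:~R = j%:R :> R by rewrite intrB -pmulrn -natr1 addrK.
  rewrite -pmulrn -natr1 /tauT; case: (leP tau) => ?; apply/andP; split; lra.
by rewrite -!pmulrn -natr1; ring.
Qed.

Lemma mesh_eps_time (R : realType) (d d1 : nat) (tau h T eps : R)
    (ell : sidx d1 -> 'rV[R]_d) (l : 'rV[R]_d) p :
  mesh_eps tau h T ell eps l p -> exists j : nat, p.1 = Num.min (j%:R * tau) T.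
Proof. by move=> [_ [i [[j [i' ->]] ->]]]; exists j. Qed.

(** * Near-optimal controls *)

Section NearOptimalControl.
Variables (R : realType) (d d1 : nat) (A : Type) (tau h T : R).
Variables (ell : sidx d1 -> 'rV[R]_d).
Variables (sigma b : A -> sidx d1 -> R -> 'rV[R]_d -> R).
Variables (c f : A -> R -> 'rV[R]_d -> R) (u : R -> 'rV[R]_d -> R).

Definition control_residual (alpha : A) (t : R) (x : 'rV[R]_d) : R :=
  deltaT tau T u t x
  + (\sum_k acoef sigma alpha k t x * Delta h (ell k) u t x
     + \sum_k b alpha k t x * delta h (ell k) u t x
     - c alpha t x * u t x + f alpha t x).

Lemma bellman_fin t x :
  ((deltaT tau T u t x)%:E + bellman h ell sigma b c f u t x = 0)%E ->
  bellman h ell sigma b c f u t x = (- deltaT tau T u t x)%:E.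
Proof.
by case: bellman => [s| |] //= [] /eqP; rewrite addrC addr_eq0 => /eqP ->.
Qed.

Lemma control_residual_le0 alpha t x :
  ((deltaT tau T u t x)%:E + bellman h ell sigma b c f u t x = 0)%E ->
  control_residual alpha t x <= 0.
Proof.
move=> /bellman_fin E; rewrite /control_residual addrC -lerBrDr sub0r -lee_fin.
by rewrite -E; apply: ereal_sup_ubound; exists alpha.
Qed.

(** The supremum over controls need not be attained, so a control is taken that misses it by less
    than [kappa]. *)
Lemma control_residual_gt kappa t x : 0 < kappa ->
  ((deltaT tau T u t x)%:E + bellman h ell sigma b c f u t x = 0)%E ->
  exists alpha, - kappa < control_residual alpha t x.
Proof.
move=> k0 /bellman_fin E.
have : ((- deltaT tau T u t x - kappa)%:E < bellman h ell sigma b c f u t x)%E.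
  by rewrite E lte_fin ltrBlDr ltrDl.
move=> /ereal_sup_gt[_ [alpha _ <-]]; rewrite lte_fin => H.
by exists alpha; rewrite /control_residual; lra.
Qed.

End NearOptimalControl.

(** * The global estimate *)

Theorem theorem5p2 (R : realType) (K : R) (d1 : nat) (hK : 1 <= K)
    (hd1 : (0 < d1)%N) :
  exists N : R, 0 < N /\
  forall (d : nat) (A : metricType R) (T lambda tau h : R)
    (ell : sidx d1 -> 'rV[R]_d)
    (sigma b : A -> sidx d1 -> R -> 'rV[R]_d -> R)
    (c f : A -> R -> 'rV[R]_d -> R)
    (eps : R) (l : 'rV[R]_d) (Q : set (R * 'rV[R]_d))
    (u : R -> 'rV[R]_d -> R) (c0 : R),
  (0 < d)%N -> separable A ->
  0 < T -> 0 <= lambda -> 0 < tau -> 0 < h ->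
  (forall k, ell k = - ell (sidx_opp k)) ->
  (forall k, enorm (ell k) <= K) ->
  (forall alpha k t x, sigma alpha k t x = sigma alpha (sidx_opp k) t x) ->
  (forall alpha k t x, 0 <= b alpha k t x) ->
  (forall alpha t x, lambda <= c alpha t x) ->
  (forall alpha k x, measurable_fun setT (fun t : R => sigma alpha k t x)) ->
  (forall alpha k x, measurable_fun setT (fun t : R => b alpha k t x)) ->
  (forall alpha x, measurable_fun setT (fun t : R => c alpha t x)) ->
  (forall alpha x, measurable_fun setT (fun t : R => f alpha t x)) ->
  (forall k t x, continuous (fun alpha : A => sigma alpha k t x)) ->
  (forall k t x, continuous (fun alpha : A => b alpha k t x)) ->
  (forall t x, continuous (fun alpha : A => c alpha t x)) ->
  (forall t x, continuous (fun alpha : A => f alpha t x)) ->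
  0 < eps <= K * h -> enorm l = 1 ->
  Q `<=` mesh_eps tau h T ell eps l -> finite_set Q -> Q !=set0 ->
  solves tau h T ell sigma b c f Q u ->
  (forall p, Qint tau h T ell Q eps l p -> forall alpha : A,
     [/\ (forall k, lip_bound K h eps ell l (b alpha k) p.1 p.2),
         lip_bound K h eps ell l (fun t x => c alpha t x - lambda) p.1 p.2,
         lip_bound K h eps ell l (f alpha) p.1 p.2 &
         (forall k,
            diffusion_bound K h eps ell l (acoef sigma alpha k) p.1 p.2)]) ->
  0 <= c0 ->
  lambda + (1 - expR (- (c0 * tau))) / tau > N ->
  forall p, Q p ->
    let M := N * expR (c0 * (T + tau)) *
             (1 + supnorm Q u + bdry_max tau h T ell Q eps l u) in
    `|delta eps l u p.1 p.2| <= M /\ `|delta eps (- l) u p.1 p.2| <= M.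
Proof.
pose n : R := #|gidx d1|%:R; pose J : R := #|sidx d1|%:R.
pose N0 := J * (diffusion_const n K + drift_const n K) + 1.
have K0 : 0 <= K by lra.
have n1 : 1 <= n by rewrite ler1n; apply/card_gt0P; exists (inr true).
have n0 : 0 <= n by lra.
have N01 : 1 <= N0.
  rewrite lerDr mulr_ge0 ?ler0n // /diffusion_const /drift_const.
  by rewrite addr_ge0 // mulr_ge0 // !addr_ge0 // !mulr_ge0 // exprn_ge0.
pose C := n * (2 * K + 1).
have C1 : 1 <= C by rewrite /C; nra.
(* [N0] is the threshold demanded by the interior estimate, and [C] is large enough that
   [C * (1 + U + B)] dominates both the interior bound [n * (K * U + K + 1)] and the boundary bound
   [n * B]. *)
exists (N0 + C); split; first lra.
move=> d A T lambda tau h ell sigma b c f eps l Q u c0 _ _ T0 lam0 tau0 h0 ellN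
  _ _ bpos clam _ _ _ _ _ _ _ _ /[dup] epsK /andP[eps0 _] _ QM Qfin Q0 uS
  coef c00 Nlt p Qp.
set U := supnorm Q u; set B := bdry_max tau h T ell Q eps l u; move=> M.
pose w r t x := negp (grad h eps ell l u r t x).
pose V (q : R * 'rV[R]_d) :=
  time_weight c0 tau q.1 ^+ 2 * \sum_r w r q.1 q.2 ^+ 2.
have step0 (r : gidx d1) : 0 < gstep h eps r by case: r.
have bdfin : finite_set (Qbdry tau h T ell Q eps l) by exact: finite_setD.
pose G q := \big[Num.max/0]_(k : sidx d1) `|delta h (ell k) u q.1 q.2|
           + `|delta eps l u q.1 q.2| + `|delta eps (- l) u q.1 q.2|.
have max0 q : 0 <= \big[Num.max/0]_(k : sidx d1) `|delta h (ell k) u q.1 q.2|.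
  exact: bigmax_ge_id.
have B0 : 0 <= B by apply: sup_finite_ge0 => // q _; rewrite !addr_ge0.
have U0 : 0 <= U by exact: sup_finite_ge0.
have uU q : Q q -> `|u q.1 q.2| <= U.
  exact: (le_sup_finite (fun q => `|u q.1 q.2|) Qfin).
have gradB r q : Q q -> ~ Qint tau h T ell Q eps l q ->
    `|grad h eps ell l u r q.1 q.2| <= B.
  move=> Qq nq; apply: le_trans (le_sup_finite G bdfin (conj Qq nq)).
  rewrite /G; case: r => [k|[]] /=.
  - by rewrite -addrA ler_wpDr ?addr_ge0 //;
      exact: (le_bigmax 0 (fun k => `|delta h (ell k) u q.1 q.2|)).
  - by rewrite -addrA ler_wpDl // lerDl.
  - by rewrite ler_wpDl // addr_ge0.
have shiftQ q r : Qint tau h T ell Q eps l q ->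
    Q (q.1, q.2 + gstep h eps r *: gdir ell l r).
  case=> _ _ Qk Ql Ql'; case: r => [[[] k]|[]] //=; try by case: (Qk k).
    by rewrite ellN /sidx_opp /= scalerN; case: (Qk k).
  by rewrite scalerN.
have time q : Q q -> 0 <= q.1 <= T.
  move=> /QM /mesh_eps_time[j ->]; rewrite ge_min lexx orbT le_min (ltW T0).
  by rewrite mulr_ge0 // ltW.
have wt1 q : Q q -> 1 <= time_weight c0 tau q.1.
  by move=> /time /andP[? ?]; exact: time_weight_ge1.
have wtE q : Q q -> time_weight c0 tau q.1 <= expR (c0 * (T + tau)).
  by move=> /time /andP[? ?]; exact: time_weight_le.
pose L := C * (1 + U + B).
have L0 : 0 <= L by rewrite mulr_ge0 //; lra.
have [[t x] Qtx Vmax] := finite_set_argmax V Qfin Q0.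
have Sbound : \sum_r w r t x ^+ 2 <= L ^+ 2.
  have [inn|nin] := pselect (Qint tau h T ell Q eps l (t, x)); last first.
    have wB r : w r t x <= B.
      by apply: le_trans (negp_le_norm _) (gradB r (t, x) _ _).
    apply: (@le_trans _ _ (n * B ^+ 2)).
      rewrite mulr_natl -sumr_const; apply: ler_sum => r _.
      by rewrite ler_sqr ?nnegrE ?negp_ge0.
    apply: (@le_trans _ _ ((n * B) ^+ 2)).
      by rewrite exprMn ler_wpM2r ?sqr_ge0 // expr2 ler_peMl.
    rewrite ler_sqr ?nnegrE ?(mulr_ge0 n0 B0) // /L /C -mulrA ler_wpM2l //; nra.
  have S0 : 0 <= \sum_r w r t x ^+ 2 by apply: sumr_ge0 => r _; exact: sqr_ge0.
  have [->|Sn0] := eqVneq (\sum_r w r t x ^+ 2) 0; first exact: sqr_ge0.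
  set m := Num.sqrt (\sum_r w r t x ^+ 2).
  have mE : \sum_r w r t x ^+ 2 = m ^+ 2 by rewrite sqr_sqrtr.
  have m0 : 0 < m by rewrite sqrtr_gt0 lt_neqAle eq_sym Sn0.
  (* With this tolerance the residual exceeds [- min h eps] at the maximum point and is at most [0]
     at every shifted point, so each of its quotients is at most [1] whichever step is used. *)
  have kap0 : 0 < Num.min h eps by rewrite lt_min h0.
  have [[_ /= /andP[t0 tT]] Qt Qk Ql Ql'] := inn.
  have eqn q : Q (t, q) ->
      ((deltaT tau T u t q)%:E + bellman h ell sigma b c f u t q = 0)%E.
    by move=> Qq; apply: (uS (t, q)); split => //=; rewrite t0.
  have [alpha Falpha] := control_residual_gt kap0 (eqn x Qtx).
  have [bL cL fL aD] := coef _ inn alpha.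
  have wt2 : 0 < time_weight c0 tau t ^+ 2 by rewrite exprn_gt0 // expR_gt0.
  have mL : m <= n * (K * U + K + 1).
    apply: (interior_estimate (lambda := lambda) (rho := expR (- (c0 * tau)))
      (T := T) (a := acoef sigma alpha) (b := b alpha) (c := c alpha)
      (f := f alpha) (u := u) (t := t) (x := x) hK h0 epsK tau0) => //.
    - exact: expR_gt0.
    - by move=> k y; rewrite mulr_ge0 ?invr_ge0 ?sqr_ge0.
    (* A spatial shift keeps the time, so the common weight cancels from the maximality of [V]. *)
    - move=> k; rewrite -mE -(ler_pM2l wt2).
      exact: (Vmax (t, _) (shiftQ (t, x) (inl k) inn)).
    (* Since [t < T], the time is an untruncated multiple of [tau]; the weight gains
       [expR (c0 * tau)] over the next step, so maximality of [V] forces the decay factor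
       [rho ^+ 2]. *)
    - have [j] := mesh_eps_time (QM _ Qtx); rewrite /= => tj.
      have tj' : t = j%:R * tau.
        by move: tj tT; case: (leP (j%:R * tau)) => // _ ->; rewrite ltxx.
      have wt2' : 0 < time_weight c0 tau (t + tauT tau T t) ^+ 2.
        by rewrite exprn_gt0 // expR_gt0.
      rewrite -mE -(ler_pM2l wt2') mulrCA mulrA -exprMn.
      have := Vmax _ Qt; rewrite /V /= => /le_trans; apply.
      by rewrite {1}tj' (@time_weight_step _ _ _ T) -?tj'.
    - move=> r; rewrite ler_pdivrMr // mul1r.
      have := control_residual_le0 alpha (eqn _ (shiftQ (t, x) r inn)).
      have : Num.min h eps <= gstep h eps r.
        by case: r => [k|s]; rewrite /= ge_min lexx ?orbT.
      move: Falpha; rewrite /control_residual /=; lra.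
    - exact: (uU (t, x)).
    - rewrite -/J -/n -/N0; lra.
  rewrite mE ler_sqr ?nnegrE ?(ltW m0) //; apply: le_trans mL _.
  rewrite /L /C -mulrA ler_wpM2l //; nra.
(* The weight is at least [1] at [q] and at most [expR (c0 * (T + tau))] at the maximum point, so
   comparing [V] there loses only this factor. *)
have wbound q r : Q q -> w r q.1 q.2 <= expR (c0 * (T + tau)) * L.
  move=> Qq; have E0 := expR_ge0 (c0 * (T + tau)).
  rewrite -ler_sqr ?nnegrE ?negp_ge0 ?(mulr_ge0 E0 L0) // exprMn.
  have le1 : w r q.1 q.2 ^+ 2 <= \sum_r w r q.1 q.2 ^+ 2.
    rewrite (bigD1 r) //= lerDl; apply: sumr_ge0 => i _; exact: sqr_ge0.
  have le2 : \sum_r w r q.1 q.2 ^+ 2 <= V q.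
    rewrite ler_peMl ?expr_ge1 ?wt1 //; last exact: le_trans (wt1 _ Qq).
    by apply: sumr_ge0 => i _; exact: sqr_ge0.
  apply: le_trans le1 (le_trans le2 (le_trans (Vmax q Qq) _)).
  apply: ler_pM => //; first exact: sqr_ge0.
    by apply: sumr_ge0 => i _; exact: sqr_ge0.
  by rewrite ler_sqr ?nnegrE //; [exact: (wtE (t, x))|exact: expR_ge0].
have final r : `|grad h eps ell l u r p.1 p.2| <= M.
  have E1 : 1 <= expR (c0 * (T + tau)).
    by rewrite -expR0 ler_expR mulr_ge0 // addr_ge0 // ltW.
  have LM : expR (c0 * (T + tau)) * L <= M.
    rewrite /M /L -/U -/B mulrCA mulrA; apply: ler_wpM2r; first by lra.
    by apply: ler_wpM2r; lra.
  (* Reversing the direction requires the shifted point to lie in [Q], which holds at interior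
     points; elsewhere [B] bounds the quotient directly. *)
  have [inn|nin] := pselect (Qint tau h T ell Q eps l p).
    apply: le_trans LM; apply: (normr_grad_le ellN); first exact: wbound.
    exact: (wbound (p.1, _) _ (shiftQ p r inn)).
  apply: le_trans (gradB r p Qp nin) (le_trans _ LM).
  have BL : B <= L by rewrite /L; nra.
  by apply: le_trans BL _; rewrite ler_peMl.
by split; [exact: (final (inr true))|exact: (final (inr false))].
Qed.
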